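(* Let $\mathbb{F}$ be an arbitrary field and let $a,d,k\in\mathbb{N}$ with $a\le d$. Then the Foulkes--Howe map $$\alpha_d:\ \mathrm{Sym}^d\,\mathrm{Sym}_{ka}(\mathbb{F}^2)^{\star\star}\longrightarrow \mathrm{Sym}^{kd}\,\mathrm{Sym}_a(\mathbb{F}^2)^{\star\star}$$ is dual to the $k$-fold map $$\kappa_{a,d}^k:\ \mathrm{Sym}_{kd}\,\mathrm{Sym}^{a}(\mathbb{F}^2)^{\star}=\Lambda^{\mathbb{F}}_{\le a}[\mathbf{x}_{kd}]\longrightarrow \Lambda^{\mathbb{F}}_{\le ka}[\mathbf{x}_{d}]=\mathrm{Sym}_d\,\mathrm{Sym}^{ka}(\mathbb{F}^2)^{\star}.$$ That is, under the canonical identifications $\big(\mathrm{Sym}_{m}\mathrm{Sym}^{n}(\mathbb{F}^2)^{\star}\big)^\star=\mathrm{Sym}^{m}\mathrm{Sym}_{n}(\mathbb{F}^2)^{\star\star}$, one has $(\kappa_{a,d}^k)^\star=\alpha_d$.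
   Context: $V^\star$ denotes the dual of a vector space $V$. For $n\in\mathbb{N}$, $\mathrm{Sym}_nV=(V^{\otimes n})^{S_n}$ denotes invariants and $\mathrm{Sym}^nV$ denotes the coinvariants of $V^{\otimes n}$ under $S_n$, i.e. the degree $n$ part of the symmetric (polynomial) algebra $\mathrm{Sym}^\bullet V$. Polynomial models. Let $U=\mathbb{F}^2=\langle x,y\rangle$, $U^\star=\langle X,Y\rangle$ the dual basis. Setting $Y=1$, identify $\mathrm{Sym}^nU^\star$ (binary forms of degree $n$) with $\mathbb{F}_{\le n}[X]$, polynomials of degree at most $n$. Then $\mathrm{Sym}_m\mathrm{Sym}^nU^\star$ is identified with $\Lambda^{\mathbb{F}}_{\le n}[\mathbf{x}_m]$, the $\mathbb{F}$-vector space of symmetric polynomials in $\mathbf{x}_m=(x_1,\dots,x_m)$ of degree at most $n$ in each variable. The $k$-fold map. $\kappa_{a,d}^k:\Lambda^{\mathbb{F}}_{\le a}[\mathbf{x}_{kd}]\to\Lambda^{\mathbb{F}}_{\le ka}[\mathbf{y}_d]$ sends $f(x_1,\dots,x_{kd})$ to $f(y_1,\dots,y_1,\,y_2,\dots,y_2,\,\dots,\,y_d,\dots,y_d)$, each $y_i$ repeated $k$ times (i.e. $x_i\mapsto y_{\lceil i/k\rceil}$). The Foulkes--Howe map. The space $\mathrm{Sym}_nU^{\star\star}=(\mathrm{Sym}^nU^\star)^\star$ has basis $\mathrm{coeff}_{X^i}$, $0\le i\le n$, where $\mathrm{coeff}_{X^i}$ extracts the coefficient of $X^i$ from an element of $\mathbb{F}_{\le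 n}[X]$. Thus $\mathrm{Sym}^\bullet\mathrm{Sym}_nU^{\star\star}$ is the coordinate ring of $\mathrm{Sym}^nU^\star$. The $k$-th power map $F\mapsto F^k$, $\mathbb{F}_{\le a}[X]\to\mathbb{F}_{\le ka}[X]$, induces the algebra homomorphism $\nu_k^\star:\mathrm{Sym}^\bullet\mathrm{Sym}_{ka}U^{\star\star}\to\mathrm{Sym}^\bullet\mathrm{Sym}_{a}U^{\star\star}$ given on generators by $$\mathrm{coeff}_{X^i}\mapsto\sum_{\substack{\beta_1+\cdots+\beta_k=i\\0\le\beta_j\le a}}\mathrm{coeff}_{X^{\beta_1}}\mathrm{coeff}_{X^{\beta_2}}\cdots\mathrm{coeff}_{X^{\beta_k}}\qquad(0\le i\le ka).$$ The Foulkes--Howe map $\alpha_d$ is the restriction of $\nu_k^\star$ to the degree $d$ part; its image lies in degree $kd$. Identification of duals. The element $\mathrm{coeff}_{X^{i_1}}\cdots\mathrm{coeff}_{X^{i_m}}$ of $\mathrm{Sym}^m\mathrm{Sym}_nU^{\star\star}$ is identified with the linear functional on $\mathrm{Sym}_m\mathrm{Sym}^nU^\star=\Lambda^{\mathbb{F}}_{\le n}[\mathbf{x}_m]$ that extracts the coefficient of the monomial $x_1^{i_1}\cdots x_m^{i_m}$. *)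

(* Defs.v *)
From HB Require Import structures.
From mathcomp Require Import all_boot all_fingroup all_algebra.
From mathcomp Require Import ssrcomplements mpoly.

Set Implicit Arguments.
Unset Strict Implicit.
Unset Printing Implicit Defensive.

Import GRing.Theory.
Local Open Scope ring_scope.

Section BoundedSymmetricPolynomials.
Context (F : fieldType) (n m : nat).
Implicit Types (A : 'X_{1..m}).

Definition symle_pred : pred {mpoly F[m]} := fun p =>
  (p \is symmetric) && all (fun A => [forall j, (A j <= n)%N]) (msupp p).
Arguments symle_pred _ /.
Definition symle : qualifier 0 {mpoly F[m]} := [qualify p | symle_pred p].

Lemma symleP (p : {mpoly F[m]}) :
  reflect (p \is symmetric /\
           forall A, p@_A != 0 -> forall j, (A j <= n)%N) (p \is symle).
Proof.
apply: (iffP andP) => -[sp bp]; split=> //.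
  by move=> A; rewrite -mcoeff_msupp => /(allP bp) /forallP.
by apply/allP => A; rewrite mcoeff_msupp => /bp h; apply/forallP.
Qed.

Fact symle_submod_closed : submod_closed symle.
Proof.
split=> [|c p q /symleP[sp bp] /symleP[sq bq]]; apply/symleP; split.
- exact: rpred0.
- by move=> A; rewrite mcoeff0 eqxx.
- by rewrite rpredD ?rpredZ.
- move=> A; rewrite mcoeffD mcoeffZ.
  have [-> |/bp//] := eqVneq p@_A 0.
  by rewrite mulr0 add0r => /bq.
Qed.

HB.instance Definition _ :=
  GRing.isSubmodClosed.Build F {mpoly F[m]} symle_pred symle_submod_closed.

(* Symmetric polynomials in m variables, of degree at most n in each variable: *)
(* the model of Sym_m Sym^n U^* for U^* = <X, Y>, obtained by setting Y = 1.   *)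
Record symle_poly := SymlePoly {
  mpoly_of_symle :> {mpoly F[m]};
  _ : mpoly_of_symle \is symle
}.

HB.instance Definition _ := [isSub for @mpoly_of_symle].
HB.instance Definition _ := [Choice of symle_poly by <:].
HB.instance Definition _ := [SubChoice_isSubLmodule of symle_poly by <:].

(* Sym^m Sym_n U^**: the degree m part of the polynomial algebra on the basis  *)
(* coeff_{X^0}, ..., coeff_{X^n} of Sym_n U^**; 'X_i stands for coeff_{X^i}.   *)
Definition symcoeff := dhomog n.+1 F m.
HB.instance Definition _ := Vector.on symcoeff.
HB.instance Definition _ := SubType.on symcoeff.

Implicit Types (p : symle_poly) (P : symcoeff).

(* The monomial x_1^{i_1} ... x_m^{i_m} attached to an index sequence i.       *)
Definition expo (i : seq 'I_n.+1) : 'X_{1..m} :=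
  [multinom nat_of_ord (nth ord0 i j) | j < m].

Lemma expo_inj (s t : m.-tuple 'I_n.+1) : expo s = expo t -> s = t.
Proof.
move=> /mnmP e; apply: eq_from_tnth => j; apply: val_inj.
by have := e j; rewrite !mnmE -!tnth_nth.
Qed.

Lemma expo_perm p (s t : m.-tuple 'I_n.+1) :
  perm_eq s t -> p@_(expo s) = p@_(expo t).
Proof.
case/tuple_permP => u ->.
have /symleP[sp _] := valP p.
rewrite -(msym_coeff (expo t) u sp); congr (_@_ _).
by apply/mnmP=> j; rewrite !mnmE -!tnth_nth tnth_mktuple.
Qed.

Lemma mdeg_s2m (t : m.-tuple 'I_n.+1) : mdeg (s2m t) = m.
Proof.
rewrite mdegE (eq_bigr (fun i => \sum_(j <- t | j == i) 1)%N); last first.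
  by move=> i _; rewrite mnmE sum1_count.
rewrite (exchange_big_dep predT)//=.
transitivity (\sum_(j <- t) 1)%N; last by rewrite sum1_size size_tuple.
by apply: eq_bigr => i _; rewrite (eq_bigl _ _ (eq_sym _)) big_pred1_eq.
Qed.

Lemma perm_m2s (t : seq 'I_n.+1) : perm_eq (m2s (s2m t)) t.
Proof.
apply/allP=> /= i _; apply/eqP.
by have /mnmP/(_ i) := s2mK (s2m t); rewrite !mnmE.
Qed.

Lemma expo_m2s p (t : m.-tuple 'I_n.+1) :
  p@_(expo (m2s (s2m t))) = p@_(expo t).
Proof.
have sz : size (m2s (s2m t)) == m by rewrite size_m2s mdeg_s2m.
exact: (@expo_perm p (Tuple sz) t (perm_m2s t)).
Qed.

Let toc_fun p : {mpoly F[n.+1]} :=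
  \sum_(M : 'X_{1..n.+1 < m.+1} | mdeg M == m) p@_(expo (m2s M)) *: 'X_[M].

Let toc_homog p : toc_fun p \is m.-homog.
Proof. by apply: rpred_sum => M dM; rewrite rpredZ ?dhomogX. Qed.

Let toc p : symcoeff := DHomog (toc_homog p).

Let toc_coeff p (M : 'X_{1..n.+1}) :
  mdeg M = m -> (toc p)@_M = p@_(expo (m2s M)).
Proof.
move=> dM; have lt : (mdeg M < m.+1)%N by rewrite dM.
rewrite /= /toc_fun raddf_sum (bigD1 (BMultinom lt)) /= ?dM//.
rewrite mcoeffZ mcoeffX eqxx mulr1 big1 ?addr0// => N /andP[_ ne].
have /negPf nN : bmnm N != M by apply: contra ne => /eqP e; apply/eqP/val_inj.
by rewrite mcoeffZ mcoeffX nN mulr0.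
Qed.

Let tos_fun P : {mpoly F[m]} :=
  \sum_(t : m.-tuple 'I_n.+1) P@_(s2m t) *: 'X_[expo t].

Let tos_coeff P (t : m.-tuple 'I_n.+1) : (tos_fun P)@_(expo t) = P@_(s2m t).
Proof.
rewrite /tos_fun raddf_sum (bigD1 t) //= mcoeffZ mcoeffX eqxx mulr1.
rewrite big1 ?addr0// => s ne; rewrite mcoeffZ mcoeffX.
have /negPf -> : expo s != expo t by apply: contra ne => /eqP /expo_inj ->.
by rewrite mulr0.
Qed.

Let expo_of A : (forall j, (A j <= n)%N) -> exists t : m.-tuple 'I_n.+1, A = expo t.
Proof.
move=> le; exists [tuple inord (A j) | j < m]; apply/mnmP => j.
by rewrite mnmE -tnth_nth tnth_mktuple inordK ?ltnS.
Qed.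

Let expo_le (t : seq 'I_n.+1) j : (expo t j <= n)%N.
Proof. by rewrite mnmE -ltnS. Qed.

Let tos_supp P A : (tos_fun P)@_A != 0 -> forall j, (A j <= n)%N.
Proof.
move=> nz; have [/forallP//|/forallP nle] := boolP [forall j, (A j <= n)%N].
case/eqP: nz; rewrite raddf_sum big1 // => t _ /=.
rewrite mcoeffZ mcoeffX; case: eqP; rewrite ?mulr0// => e.
by case: nle => j; rewrite -e.
Qed.

Let tos_symle P : tos_fun P \is symle.
Proof.
apply/symleP; split; last exact: tos_supp.
apply/issymP => u; apply/mpolyP => A; rewrite mcoeff_sym.
have [/forallP le|/forallP nle] := boolP [forall j, (A j <= n)%N].
  have [t ->] := expo_of le.
  have -> : [multinom expo t (u i) | i < m] = expo [tuple tnth t (u i) | i < m].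
    by apply/mnmP=> j; rewrite !mnmE -!tnth_nth tnth_mktuple.
  rewrite !tos_coeff; congr (_@_ _); apply/mnmP => i; rewrite !mnmE.
  have /seq.permP : perm_eq [tuple tnth t (u j) | j < m] t.
    by apply/tuple_permP; exists u.
  exact.
transitivity (0 : F).
  apply/eqP/negPn/negP => /tos_supp h; case: nle => j.
  by have := h (u^-1%g j); rewrite mnmE permKV.
by apply/esym/eqP/negPn/negP => /tos_supp.
Qed.

Let tos P := SymlePoly (tos_symle P).

Let tocK : cancel toc tos.
Proof.
move=> p; apply/val_inj/mpolyP => A.
have /symleP[_ bp] := valP p.
have [/forallP le|/forallP nle] := boolP [forall j, (A j <= n)%N].
  have [t ->] := expo_of le.
  by rewrite tos_coeff toc_coeff ?mdeg_s2m ?expo_m2s.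
transitivity (0 : F); last by apply/esym/eqP/negPn/negP => /bp.
by apply/eqP/negPn/negP => /tos_supp.
Qed.

Let tosK : cancel tos toc.
Proof.
move=> P; apply/val_inj/mpolyP => M.
have [dM|ndM] := eqVneq (mdeg M) m; last first.
  by rewrite !(@dhomog_nemf_coeff _ _ mdeg m) ?dhomog_is_dhomog.
rewrite toc_coeff //.
have sz : size (m2s M) == m by rewrite size_m2s dM.
by rewrite (tos_coeff P (Tuple sz)) /= s2mK.
Qed.

Let toc_linear : linear toc.
Proof.
move=> c p q; apply/val_inj; rewrite /= /toc_fun scaler_sumr -big_split.
by apply: eq_bigr => M _; rewrite /= mcoeffD mcoeffZ scalerDl scalerA.
Qed.

Fact symle_vecaxiom : Vector.axiom 'C(m + n, m) symle_poly.
Proof.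
have [f fL fB] := dhomog_vecaxiom n F m.
exists (f \o toc); first by move=> c p q; rewrite /= toc_linear fL.
by apply: bij_comp fB _; exists tos.
Qed.

HB.instance Definition _ :=
  Lmodule_hasFinDim.Build F symle_poly symle_vecaxiom.

(* The identification of Sym^m Sym_n U^** with the dual of Sym_m Sym^n U^*. As *)
(* m2s M lists each i with multiplicity M i, a monomial                        *)
(* coeff_{X^{i_1}} ... coeff_{X^{i_m}} is sent to the functional extracting    *)
(* the coefficient of x_1^{i_1} ... x_m^{i_m}, for i_1 <= ... <= i_m; by       *)
(* symmetry any other ordering gives the same functional (dual_ident_prodX).   *)
Definition coeff_pairing P p : F^o :=
  \sum_(M <- msupp P) P@_M * p@_(expo (m2s M)).

Fact coeff_pairing_linear P : linear (coeff_pairing P).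
Proof.
move=> c p q; rewrite /coeff_pairing scaler_sumr -big_split.
apply: eq_bigr => M _ /=.
by rewrite mcoeffD mcoeffZ mulrDr mulrCA.
Qed.

HB.instance Definition _ P :=
  GRing.isLinear.Build F symle_poly F^o *:%R (coeff_pairing P)
    (coeff_pairing_linear P).

Lemma coeff_pairingwE (w : nat) P p : (msize P <= w)%N ->
  coeff_pairing P p =
  \sum_(M : 'X_{1..n.+1 < w}) P@_M * p@_(expo (m2s M)).
Proof.
move=> le; rewrite /coeff_pairing.
pose I : subFinType _ := 'X_{1..n.+1 < w}.
rewrite (big_mksub I) /=; first last.
- by move=> x /msize_mdeg_lt/leq_trans; apply.
- by rewrite msupp_uniq.
by rewrite big_rmcond //= => M; move/memN_msupp_eq0 ->; rewrite mul0r.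
Qed.

Definition dual_ident_fun P : 'Hom(symle_poly, F^o) :=
  linfun (coeff_pairing P).

Fact dual_ident_linear : linear dual_ident_fun.
Proof.
move=> c P Q; apply/lfunP => p; rewrite !lfunE /= !lfunE /= !lfunE /=.
set w := maxn (msize (c *: P + Q)) (maxn (msize P) (msize Q)).
rewrite !(@coeff_pairingwE w) ?leq_max ?leqnn ?orbT //.
rewrite scaler_sumr -big_split; apply: eq_bigr => M _ /=.
by rewrite mcoeffD mcoeffZ mulrDl -mulrA.
Qed.

HB.instance Definition _ :=
  GRing.isLinear.Build F symcoeff 'Hom(symle_poly, F^o) *:%R dual_ident_fun
    dual_ident_linear.

Definition dual_ident : 'Hom(symcoeff, 'Hom(symle_poly, F^o)) :=
  linfun dual_ident_fun.

Lemma dual_identE P p :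
  dual_ident P p = \sum_(M <- msupp P) P@_M * p@_(expo (m2s M)).
Proof. by rewrite !lfunE. Qed.

Let prodXE (t : m.-tuple 'I_n.+1) :
  \prod_(j < m) 'X_(tnth t j) = 'X_[s2m t] :> {mpoly F[n.+1]}.
Proof.
transitivity ('X_[\sum_(j < m) U_(tnth t j)] : {mpoly F[n.+1]}).
  by apply/esym/big_morph; [exact: mpolyXD | exact: mpolyX0].
congr 'X_[_]; apply/mnmP=> i; rewrite mnm_sumE !mnmE -sum1_count.
rewrite big_tuple [RHS]big_mkcond /=.
by apply: eq_bigr => j _; rewrite mnm1E; case: eqP.
Qed.

Fact prodX_homog (t : m.-tuple 'I_n.+1) :
  (\prod_(j < m) 'X_(tnth t j) : {mpoly F[n.+1]}) \is m.-homog.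
Proof.
by rewrite prodXE dhomogX; apply/eqP/mdeg_s2m.
Qed.

Lemma dual_ident_prodX (t : m.-tuple 'I_n.+1) p :
  dual_ident (DHomog (prodX_homog t)) p =
  p@_[multinom nat_of_ord (tnth t j) | j < m].
Proof.
rewrite dual_identE.
have -> : DHomog (prodX_homog t) = 'X_[s2m t] :> {mpoly F[n.+1]} := prodXE t.
rewrite msuppX big_seq1 mcoeffX eqxx mul1r expo_m2s; congr (_@_ _).
by apply/mnmP=> j; rewrite !mnmE -tnth_nth.
Qed.

Lemma dual_ident_bij : bijective dual_ident.
Proof.
have ker0 : lker dual_ident == 0%VS.
  apply/lker0P => P Q e; apply/val_inj/mpolyP => M.
  have [dM|ndM] := eqVneq (mdeg M) m; last first.
    by rewrite !(@dhomog_nemf_coeff _ _ mdeg m) ?dhomog_is_dhomog.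
  have hM : ('X_[M] : {mpoly F[n.+1]}) \is m.-homog by rewrite dhomogX; apply/eqP.
  suff h R : dual_ident R (tos (DHomog hM)) = R@_M by rewrite -!h e.
  rewrite dual_identE.
  transitivity (\sum_(N <- msupp R) if N == M then R@_N else 0).
    apply: eq_big_seq => N hN.
    have dN : mdeg N = m := dhomog_mf (dhomog_is_dhomog R) hN.
    have sz : size (m2s N) == m by rewrite size_m2s dN.
    rewrite /= (tos_coeff _ (Tuple sz)) /= s2mK mcoeffX eq_sym.
    by case: eqP; rewrite ?mulr1 ?mulr0.
  rewrite -big_mkcond /=; case: (boolP (M \in msupp R)) => hR.
    by rewrite (big_rem M) //= eqxx big_seq_cond big1 ?addr0 // => N /andP[];
      rewrite mem_rem_uniq ?msupp_uniq // inE => /andP[/negPf->].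
  rewrite memN_msupp_eq0 // big_seq_cond big1 // => N /andP[hN /eqP e'].
  by rewrite e' (negPf hR) in hN.
have full : limg dual_ident = fullv.
  apply/eqP; rewrite eqEdim subvf limg_dim_eq; last first.
    by rewrite (eqP ker0) capv0.
  by rewrite !dimvf /= /dim /= muln1.
exists (dual_ident^-1)%VF; first exact: lker0_lfunK.
by move=> u; rewrite limg_lfunVK // full memvf.
Qed.
End BoundedSymmetricPolynomials.

Section KFoldMap.
Context (F : fieldType) (a d k : nat).

Fact block_subproof (i : 'I_(k * d)) : (i %/ k < d)%N.
Proof.
case: k i => [|k'] i; first by case: i.
by rewrite ltn_divLR // (mulnC d) ltn_ord.
Qed.

(* With indices starting at 0, i |-> i %/ k plays the role of the ceiling of   *)
(* i / k for indices starting at 1.                                            *)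
Definition block (i : 'I_(k * d)) : 'I_d := Ordinal (block_subproof i).

Definition kfold_mpoly (f : {mpoly F[k * d]}) : {mpoly F[d]} :=
  f \mPo [tuple 'X_(block i) | i < k * d].

Lemma kfold_mpolyX (A : 'X_{1..k * d}) :
  kfold_mpoly 'X_[A] = 'X_[[multinom \sum_(i | block i == j) A i | j < d]].
Proof.
rewrite /kfold_mpoly comp_mpolyX.
under eq_bigr => i _ do rewrite tnth_mktuple.
rewrite mprodXnE; congr 'X_[_]; apply/mnmP=> j.
rewrite mnm_sumE mnmE [RHS]big_mkcond; apply: eq_bigr => i _ /=.
by rewrite mulmnE mnm1E; case: eqP; rewrite ?mul1n ?mul0n.
Qed.

Let unblock_subproof (j : 'I_d) (r : 'I_k) : (j * k + r < k * d)%N.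
Proof.
apply: (@leq_trans (j.+1 * k)); first by rewrite mulSn addnC ltn_add2r.
by rewrite mulnC leq_mul2l ltn_ord orbT.
Qed.

Let unblock j r : 'I_(k * d) := Ordinal (unblock_subproof j r).

Let unblockK j r : block (unblock j r) = j.
Proof.
apply: val_inj; have k0 : (0 < k)%N by apply: leq_trans (ltn_ord r).
by rewrite /= divnMDl // divn_small ?addn0.
Qed.

Let rem_subproof (i : 'I_(k * d)) : (i %% k < k)%N.
Proof. by case: k i => [|k'] i; [case: i | rewrite ltn_mod]. Qed.

Let rem i : 'I_k := Ordinal (rem_subproof i).

Let remK j r : rem (unblock j r) = r.
Proof. by apply: val_inj; rewrite /= modnMDl modn_small. Qed.

Let block_remK i : unblock (block i) (rem i) = i.
Proof. by apply: val_inj; rewrite /= -divn_eq. Qed.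

Fact card_block (j : 'I_d) : #|[pred i | block i == j]| = k.
Proof.
have inj : injective (unblock j) by apply: (can_inj (g := rem)) => r; apply: remK.
rewrite -[RHS]card_ord -(card_codom inj); apply: eq_card => i.
rewrite inE; apply/eqP/codomP => [<-|[r ->]]; last exact: unblockK.
by exists (rem i); rewrite block_remK.
Qed.

Fact kfold_symle (p : symle_poly F a (k * d)) :
  kfold_mpoly p \is symle F (k * a) d.
Proof.
have /symleP[sp bp] := valP p.
apply/symleP; split; last first.
  move=> A; rewrite -mcoeff_msupp /kfold_mpoly comp_mpolyEX => /msupp_sum_le.
  case/flatten_mapP => B; rewrite filter_predT => hB.
  move=> /msuppZ_le; rewrite -/(kfold_mpoly _) kfold_mpolyX msuppX.
  rewrite inE => /eqP -> j; rewrite mnmE.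
  apply: (@leq_trans (\sum_(i | block i == j) a)).
    by apply: leq_sum => i _; apply: bp; rewrite -mcoeff_msupp.
  by rewrite sum_nat_const card_block.
apply/issymP => s.
pose u i := unblock (s (block i)) (rem i).
have u_inj : injective u.
  move=> i j e; rewrite -(block_remK i) -(block_remK j).
  have := congr1 block e; have := congr1 rem e.
  by rewrite /u !remK !unblockK => -> /perm_inj ->.
suff h (q : {mpoly F[k * d]}) :
    msym s (kfold_mpoly q) = kfold_mpoly (msym (perm u_inj) q).
  by rewrite h (issymP _ sp).
have hL : msym s (kfold_mpoly q) =
    \sum_(A <- msupp q) q@_A *: msym s (kfold_mpoly 'X_[A]).
  rewrite {1}/kfold_mpoly comp_mpolyEX; apply: etrans (raddf_sum _ _ _ _) _.
  by apply: eq_bigr => A _; exact: msymZ.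
have hR : kfold_mpoly (msym (perm u_inj) q) =
    \sum_(A <- msupp q) q@_A *: kfold_mpoly (msym (perm u_inj) 'X_[A]).
  have -> : msym (perm u_inj) q =
      \sum_(A <- msupp q) q@_A *: msym (perm u_inj) 'X_[A].
    rewrite {1}(mpolyE q); apply: etrans (raddf_sum _ _ _ _) _.
    by apply: eq_bigr => A _; exact: msymZ.
  apply: etrans (raddf_sum _ _ _ _) _.
  by apply: eq_bigr => A _; exact: comp_mpolyZ.
rewrite {}hL {}hR; apply: eq_bigr => A _.
rewrite !msymX !kfold_mpolyX msymX.
congr (_ *: 'X_[_]); apply/mnmP => j; rewrite !mnmE.
rewrite [RHS](reindex_inj (@perm_inj _ (perm u_inj))) /=.
apply: eq_big => [i|i _]; last by rewrite mnmE permK.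
by rewrite permE /u unblockK (can2_eq (permK s) (permKV s)).
Qed.

Definition kfold_fun (p : symle_poly F a (k * d)) : symle_poly F (k * a) d :=
  SymlePoly (kfold_symle p).

Fact kfold_linear : linear kfold_fun.
Proof. by move=> c p q; apply/val_inj; rewrite /= /kfold_mpoly linearP. Qed.

HB.instance Definition _ :=
  GRing.isLinear.Build F (symle_poly F a (k * d)) (symle_poly F (k * a) d) *:%R
    kfold_fun kfold_linear.

Definition kfold : 'Hom(symle_poly F a (k * d), symle_poly F (k * a) d) :=
  linfun kfold_fun.

End KFoldMap.

Section FoulkesHoweMap.
Context (F : fieldType) (a d k : nat).

(* The algebra homomorphism nu_k^* : Sym Sym_{ka} U^** -> Sym Sym_a U^**       *)
(* induced by the k-th power map on forms, given by its values on generators.  *)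
Definition nu_star (P : {mpoly F[(k * a).+1]}) : {mpoly F[a.+1]} :=
  P \mPo [tuple \sum_(b : {ffun 'I_k -> 'I_a.+1} | (\sum_j b j)%N == i :> nat)
                  \prod_j 'X_(b j) | i < (k * a).+1].

Fact nu_star_homog (P : symcoeff F (k * a) d) : nu_star P \is (k * d).-homog.
Proof.
rewrite /nu_star comp_mpolyE big_seq; apply: rpred_sum => M hM; rewrite rpredZ //.
have <- : (\sum_i k * M i = k * d)%N.
  by rewrite -big_distrr -mdegE /= (dhomog_mf (dhomog_is_dhomog P) hM).
apply: (big_rec2 (fun (p : {mpoly F[a.+1]}) e => p \is e.-homog)).
  exact: dhomog1.
move=> i e p _ hp; apply: dhomogM hp; apply: dhomogMn.
rewrite tnth_mktuple; apply: rpred_sum => b _.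
suff : (\prod_j 'X_(b j) : {mpoly F[a.+1]}) \is (\sum_(j < k) 1)%N.-homog.
  by rewrite sum1_card card_ord.
apply: (big_rec2 (fun (p : {mpoly F[a.+1]}) e => p \is e.-homog)).
  exact: dhomog1.
by move=> j e' q _ hq; apply: dhomogM hq; rewrite dhomogX; apply/eqP/mdeg1.
Qed.

Definition foulkes_howe_fun (P : symcoeff F (k * a) d) : symcoeff F a (k * d) :=
  DHomog (nu_star_homog P).

Fact foulkes_howe_linear : linear foulkes_howe_fun.
Proof. by move=> c p q; apply/val_inj; rewrite /= /nu_star linearP. Qed.

HB.instance Definition _ :=
  GRing.isLinear.Build F (symcoeff F (k * a) d) (symcoeff F a (k * d)) *:%R
    foulkes_howe_fun foulkes_howe_linear.

Definition foulkes_howe : 'Hom(symcoeff F (k * a) d, symcoeff F a (k * d)) :=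
  linfun foulkes_howe_fun.

End FoulkesHoweMap.

Section DualMap.
Context (F : fieldType) (V W : vectType F) (f : 'Hom(V, W)).

Definition dual_map_fun (phi : 'Hom(W, F^o)) : 'Hom(V, F^o) := (phi \o f)%VF.

Fact dual_map_linear : linear dual_map_fun.
Proof.
by move=> c phi psi; rewrite /dual_map_fun comp_lfunDl -comp_lfunZl.
Qed.

HB.instance Definition _ :=
  GRing.isLinear.Build F 'Hom(W, F^o) 'Hom(V, F^o) *:%R dual_map_fun
    dual_map_linear.

Definition dual_map : 'Hom('Hom(W, F^o), 'Hom(V, F^o)) := linfun dual_map_fun.

Lemma dual_mapE phi : dual_map phi = (phi \o f)%VF.
Proof. by rewrite lfunE. Qed.

End DualMap.

(* Main.v *)
Require Import Defs.
From HB Require Import structures.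
From mathcomp Require Import all_boot all_fingroup all_algebra.
From mathcomp Require Import mpoly.

(** Both sides are linear, so it is enough to compare them on a product
    coeff_{X^(t_1)} ... coeff_{X^(t_d)}, and to evaluate the two resulting
    functionals at a polynomial p.  Both values turn out to be the same sum of
    coefficients of p: that of x^s over all sequences s of k * d exponents
    between 0 and a such that, for every j, the exponents in the j-th block of
    k consecutive positions add up to t_j.

    For the k-fold map this is [kfold_coeff]: identifying the variables of each
    block sends x^s to y^t, where t_j is the sum of s over the j-th block.  For
    the Foulkes-Howe map it is [foulkes_howe_prodX]: in the product over j of
    the sums defining nu_star on generators, choosing one term in each factor
    amounts to choosing d sequences of k exponents with sums t_1, ..., t_d, and
    the concatenation of these sequences is s. *)

Set Implicit Arguments.
Unset Strict Implicit.
Unset Printing Implicit Defensive.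

Import GRing.Theory.
Local Open Scope ring_scope.

Section Blocks.
Context (k d : nat).

Fact unblock_subproof (j : 'I_d) (l : 'I_k) : (j * k + l < k * d)%N.
Proof.
apply: (@leq_trans (j.+1 * k)); first by rewrite mulSn addnC ltn_add2r.
by rewrite mulnC leq_mul2l ltn_ord orbT.
Qed.

Definition unblock (j : 'I_d) (l : 'I_k) : 'I_(k * d) :=
  Ordinal (unblock_subproof j l).

Fact block_pos_subproof (i : 'I_(k * d)) : (i %% k < k)%N.
Proof. by case: k i => [|k'] i; [case: i | rewrite ltn_mod]. Qed.

Definition block_pos (i : 'I_(k * d)) : 'I_k := Ordinal (block_pos_subproof i).

Lemma block_unblock j l : block (unblock j l) = j.
Proof.
apply: val_inj; have k0 : (0 < k)%N by apply: leq_trans (ltn_ord l).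
by rewrite /= divnMDl // divn_small ?addn0.
Qed.

Lemma block_pos_unblock j l : block_pos (unblock j l) = l.
Proof. by apply: val_inj; rewrite /= modnMDl modn_small. Qed.

Lemma unblock_block i : unblock (block i) (block_pos i) = i.
Proof. by apply: val_inj; rewrite /= -divn_eq. Qed.

Lemma big_block (R : Type) (idx : R) (op : Monoid.com_law idx)
    (j : 'I_d) (G : 'I_(k * d) -> R) :
  \big[op/idx]_(i | block i == j) G i = \big[op/idx]_l G (unblock j l).
Proof.
rewrite (reindex_onto (unblock j) block_pos) /=; last first.
  by move=> i /eqP <-; exact: unblock_block.
by apply: eq_bigl => l; rewrite block_unblock block_pos_unblock !eqxx.
Qed.

Lemma big_blocks (R : Type) (idx : R) (op : Monoid.com_law idx)
    (G : 'I_(k * d) -> R) :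
  \big[op/idx]_i G i = \big[op/idx]_j \big[op/idx]_l G (unblock j l).
Proof.
rewrite (partition_big (@block d k) predT) //=.
by apply: eq_bigr => j _; exact: big_block.
Qed.

Section Cut.
Context (T : Type).

Definition cut (s : (k * d).-tuple T) : {ffun 'I_d -> {ffun 'I_k -> T}} :=
  [ffun j => [ffun l => tnth s (unblock j l)]].

Definition glue (f : {ffun 'I_d -> {ffun 'I_k -> T}}) : (k * d).-tuple T :=
  [tuple f (block i) (block_pos i) | i < k * d].

Lemma cutK : cancel cut glue.
Proof.
move=> s; apply: eq_from_tnth => i.
by rewrite tnth_mktuple !ffunE unblock_block.
Qed.

Lemma glueK : cancel glue cut.
Proof.
move=> f; apply/ffunP => j; apply/ffunP => l.
by rewrite !ffunE tnth_mktuple block_unblock block_pos_unblock.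
Qed.

End Cut.

Definition block_sum n (s : (k * d).-tuple 'I_n) (j : 'I_d) : nat :=
  (\sum_(i | block i == j) tnth s i)%N.

Lemma block_sumE n (s : (k * d).-tuple 'I_n) (j : 'I_d) :
  block_sum s j = (\sum_l cut s j l)%N.
Proof.
by rewrite /block_sum big_block; apply: eq_bigr => l _; rewrite !ffunE.
Qed.

End Blocks.

Section Monomials.
Context (F : fieldType).

Lemma prodX_s2m n (s : seq 'I_n) :
  \prod_(i <- s) 'X_i = 'X_[s2m s] :> {mpoly F[n]}.
Proof.
transitivity ('X_[\sum_(i <- s) U_(i)] : {mpoly F[n]}).
  by apply/esym/big_morph; [exact: mpolyXD | exact: mpolyX0].
congr 'X_[_]; apply/mnmP => i.
rewrite mnm_sumE mnmE -sum1_count [RHS]big_mkcond.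
by apply: eq_bigr => j _; rewrite mnm1E /=; case: eqP.
Qed.

(** A monomial of degree m is the product of the m variables listed, with
    multiplicity, by [m2s].  The coefficients c are not unique in general:
    permuting a tuple does not change the corresponding product. *)
Lemma symcoeff_span n m (P : symcoeff F n m) :
  exists c : m.-tuple 'I_n.+1 -> F,
    P = \sum_t c t *: DHomog (prodX_homog F t).
Proof.
suff [c e] : exists c : m.-tuple 'I_n.+1 -> F,
    \sum_(A <- msupp P) P@_A *: 'X_[A] =
    \sum_t c t *: \prod_(j < m) 'X_(tnth t j) :> {mpoly F[n.+1]}.
  exists c; apply: val_inj; rewrite /= [LHS]mpolyE e.
  by rewrite (raddf_sum (val : symcoeff F n m -> {mpoly F[n.+1]})).
(* The support of P is generalized to any list of monomials of degree m, so
   that the induction can add one monomial at a time. *)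
have: {in msupp P, forall A, mdeg A = m}.
  by move=> A; apply: dhomog_mf; exact: dhomog_is_dhomog.
elim: (msupp P : seq _) => [|A r IH] dr.
  by exists (fun=> 0); rewrite big_nil big1 // => t _; rewrite scale0r.
have [|c e] := IH; first by move=> B hB; apply: dr; rewrite inE hB orbT.
have sz : size (m2s A) == m by rewrite size_m2s dr ?mem_head.
exists (fun t => (if t == Tuple sz then P@_A else 0) + c t).
under [RHS]eq_bigr do rewrite scalerDl.
rewrite big_cons e big_split; congr (_ + _).
rewrite (bigD1 (Tuple sz)) //= eqxx [X in _ = _ + X]big1 ?addr0; last first.
  by move=> t /negPf ->; rewrite scale0r.
congr (_ *: _); rewrite -{1}(s2mK A) -prodX_s2m.
exact: (big_tuple _ _ (Tuple sz)).
Qed.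

(** The exponents bounded by n are exactly those of the form [expo m s], for a
    single s, so no monomial of p is missed or counted twice. *)
Lemma symle_expand n m (p : symle_poly F n m) :
  p = \sum_(s : m.-tuple 'I_n.+1) p@_(expo m s) *: 'X_[expo m s] :> {mpoly F[m]}.
Proof.
apply/mpolyP => A; rewrite raddf_sum /=.
under eq_bigr do rewrite mcoeffZ mcoeffX.
have /symleP[_ bp] := valP p.
have [/forallP le|/forallP nle] := boolP [forall j, (A j <= n)%N].
  have [t ->] : exists t : m.-tuple 'I_n.+1, A = expo m t.
    exists [tuple inord (A j) | j < m]; apply/mnmP => j.
    by rewrite mnmE -tnth_nth tnth_mktuple inordK ?ltnS.
  rewrite (bigD1 t) //= eqxx mulr1 big1 ?addr0 // => s ne.
  by case: eqP => [/expo_inj e|_]; [rewrite e eqxx in ne | rewrite mulr0].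
rewrite big1; first by apply/eqP/negPn/negP => /bp.
move=> s _; case: eqP => [e|_]; last by rewrite mulr0.
by case: nle => j; rewrite -e mnmE -ltnS.
Qed.

End Monomials.

Section Duality.
Context (F : fieldType) (a d k : nat).

(** Expand p on monomials: each x^s is sent to a single monomial, whose exponent
    at j is the sum of s over the j-th block, because the variables of that
    block all become y_j. *)
Lemma kfold_coeff (p : symle_poly F a (k * d)) (A : 'X_{1..d}) :
  (kfold F a d k p)@_A =
  \sum_(s : (k * d).-tuple 'I_a.+1 | [forall j, block_sum s j == A j])
     p@_(expo (k * d) s).
Proof.
rewrite lfunE /= {1}(symle_expand p) /kfold_mpoly.
rewrite (raddf_sum (comp_mpoly [tuple 'X_(block i) | i < k * d])) raddf_sum /=.
rewrite [RHS]big_mkcond; apply: eq_bigr => s _.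
rewrite comp_mpolyZ -/(kfold_mpoly _) kfold_mpolyX mcoeffZ mcoeffX.
have -> : ([multinom \sum_(i | block i == j) expo (k * d) s i | j < d] == A) =
    [forall j, block_sum s j == A j].
  have bE j : (\sum_(i | block i == j) expo (k * d) s i)%N = block_sum s j.
    by apply: eq_bigr => i _; rewrite mnmE -tnth_nth.
  apply/eqP/forallP => [<- j|h]; first by rewrite mnmE bE.
  by apply/mnmP => j; rewrite mnmE bE; apply/eqP.
by case: ifP; rewrite ?mulr1 ?mulr0.
Qed.

(** Expanding the product over j of the sums that define nu_star on generators
    gives a sum over families of d sequences of length k; [glue] turns such a
    family into one sequence of length k * d. *)
Lemma foulkes_howe_prodX (t : d.-tuple 'I_(k * a).+1) :
  foulkes_howe F a d k (DHomog (prodX_homog F t)) =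
  \sum_(s : (k * d).-tuple 'I_a.+1 | [forall j, block_sum s j == tnth t j])
     DHomog (prodX_homog F s).
Proof.
apply: val_inj; rewrite lfunE /=.
rewrite (raddf_sum (val : symcoeff F a (k * d) -> {mpoly F[a.+1]})) /=.
rewrite /nu_star rmorph_prod /=.
under eq_bigr do rewrite comp_mpolyXU -tnth_nth tnth_mktuple.
rewrite bigA_distr_big_dep /= (reindex (@cut k d _)) /=; last first.
  by exists (@glue k d _) => s _; [exact: cutK | exact: glueK].
apply: eq_big => [s|s _].
  by apply/familyP/forallP => h j; have := h j; rewrite ?inE block_sumE.
rewrite big_blocks; apply: eq_bigr => j _; apply: eq_bigr => l _.
by rewrite !ffunE.
Qed.

End Duality.

Theorem theorem1p2 (F : fieldType) (a d k : nat) (le_ad : (a <= d)%N) :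
  (dual_map (kfold F a d k) \o dual_ident F (k * a) d)%VF =
  (dual_ident F a (k * d) \o foulkes_howe F a d k)%VF.
Proof.
apply/lfunP => P; have [c ->] := symcoeff_span P.
rewrite !linear_sum; apply: eq_bigr => t _; rewrite !linearZ; congr (_ *: _).
rewrite /= !comp_lfunE dual_mapE foulkes_howe_prodX linear_sum.
apply/lfunP => p; rewrite comp_lfunE dual_ident_prodX kfold_coeff sum_lfunE.
apply: eq_big => [s|s _]; first by apply: eq_forallb => j; rewrite mnmE.
rewrite dual_ident_prodX; congr (_@_ _).
by apply/mnmP => j; rewrite !mnmE -tnth_nth.
Qed.
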